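(* Let $(u_n)_{n\geq 0}$ be a non-degenerate Lucas sequence, $u_n=a_1u_{n-1}+a_2u_{n-2}$, with non-zero discriminant $\Delta_u=a_1^2+4a_2$, and let $g_u(n)=\gcd(n,u_n)$. Then for every integer $k\geq 1$, $$\sum_{n\leq x} g_u(n)^{k}\leq x^{k+1}\exp\left(-\left(1+o(1)\right)\sqrt{(\log x)(\log \log x)}\right),$$ as $x$ tends to infinity, where the $o(1)$ depends on $u$ and $k$.
   Context: A Lucas sequence is a sequence of integers $(u_n)_{n\geq 0}$ with $u_0=0$, $u_1=1$ and $u_n=a_1u_{n-1}+a_2u_{n-2}$ for all $n\geq 2$, where $a_1,a_2\in\mathbb{Z}$ and $a_2\neq 0$. It is non-degenerate if no ratio $\alpha_i/\alpha_j$ ($i\neq j$) of pairwise distinct complex roots of the characteristic polynomial $X^2-a_1X-a_2$ is a root of unity. The sum runs over positive integers $n\leq x$. The symbol $o(1)$ denotes a function of $x$ tending to $0$ as $x\to\infty$, where the function may depend on the sequence $u$ and on $k$. *)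

(* Defs.v *)
From mathcomp Require Import all_boot all_order all_algebra.
From mathcomp Require Import complex.
From mathcomp Require Import all_classical all_reals all_analysis.

Set Implicit Arguments.
Unset Strict Implicit.
Unset Printing Implicit Defensive.

Import Order.TTheory GRing.Theory Num.Theory.
Import numFieldNormedType.Exports.

Local Open Scope ring_scope.

Definition lucas_sequence (a1 a2 : int) (u : nat -> int) : Prop :=
  [/\ a2 != 0, u 0%N = 0, u 1%N = 1 &
      forall n : nat, (2 <= n)%N ->
        u n = a1 * u n.-1 + a2 * u n.-2].

Definition lucas_char_poly (a1 a2 : int) : {poly int} :=
  'X^2 - a1%:P * 'X - a2%:P.

Definition is_root_of_unity (F : nzRingType) (z : F) : Prop :=
  exists2 m : nat, (0 < m)%N & m.-unity_root z.

Definition lucas_nondegenerate (R : realType) (a1 a2 : int) : Prop :=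
  forall alpha beta : R[i],
    root (map_poly intr (lucas_char_poly a1 a2)) alpha ->
    root (map_poly intr (lucas_char_poly a1 a2)) beta ->
    alpha != beta -> ~ is_root_of_unity (alpha / beta).

Definition lucas_discr (a1 a2 : int) : int := a1 ^+ 2 + 4 * a2.

Definition gcd_term (u : nat -> int) (n : nat) : nat := gcdn n `|u n|%N.

Definition gcd_power_sum (R : realType) (u : nat -> int) (k : nat) (x : R) : R :=
  \sum_(1 <= n < (Num.truncn x).+1) (gcd_term u n)%:R ^+ k.

(* Main.v *)
Require Import Defs.
From mathcomp Require Import all_boot all_order all_algebra all_field.
From mathcomp Require Import complex ring lra zify.
From mathcomp Require Import all_classical all_reals all_analysis.

Set Implicit Arguments.
Unset Strict Implicit.
Unset Printing Implicit Defensive.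

Import Order.TTheory GRing.Theory Num.Theory.
Import numFieldNormedType.Exports.

Local Open Scope classical_set_scope.
Local Open Scope ring_scope.

(** Since gcd(n, u_n) <= n, it suffices to treat k = 1. Write g(n) = gcd(n, u_n),
    L = exp (sqrt (log x log log x)), and collect the n <= x with a given value
    m = g(n).

    If p is the largest prime factor of m, and p divides neither a2 nor the
    discriminant, then p has a rank of appearance z = z(p): p | u_n implies
    z | n, and moreover z | p - 1 or z | p + 1 (lucas_rank_exists). Hence n is a
    multiple of lcm(m, z), and such n contribute at most x gcd(m, z) / z to the
    sum. Expanding gcd(m, z) over the divisors e of z and of m, one has to count the
    multiples m <= x of p e with largest prime factor p, of which the quotient
    m / (p e) is p-smooth. Values m which are smooth up to L ^ (1/2) are handled
    without using the rank (gcd_sum_split).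

    Rankin's method with exponent 1 - eta, eta = w log log x / log p and w slightly
    below 1/2, bounds the proportion of p-smooth numbers by
    exp (- w log x log log x / log p), up to a factor L ^ o(1); the Euler product is
    controlled by the sum of 1/q over primes q <= x, which is O(log log x) by
    Chebyshev's argument with central binomial coefficients (rankin_bound,
    prime_hsum_le_lnln). By the inequality between arithmetic and geometric means this
    proportion is at most L ^ (- 2 w) p ^ (1/2). The total is therefore
    L ^ (- 2 w + o(1)) times the sum over p <= x of tau(z(p)) / (z(p) p ^ (1/2)),
    which is O((log x) ^ 2) (sum_rank_le): p ^ (- 1/2) is at most 1/z + z/p, there
    are O(d) primes of rank d because they all divide u_d, which is non-zero by
    non-degeneracy, and tau(z(p)) is at most tau(p - 1) or tau(p + 1). Letting w tend
    to 1/2 gives the theorem. *)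

(** * Lucas sequences and ranks of appearance *)

Lemma lucasS (a1 a2 : int) (u : nat -> int) (n : nat) :
  lucas_sequence a1 a2 u -> u n.+2 = a1 * u n.+1 + a2 * u n.
Proof. by case=> _ _ _ ->. Qed.

(** Binet's formula, in a form valid in every commutative ring. *)
Lemma lucas_binet (F : comNzRingType) (a1 a2 : int) (u : nat -> int)
    (alpha beta : F) (n : nat) :
  lucas_sequence a1 a2 u ->
  alpha + beta = a1%:~R -> alpha * beta = - a2%:~R ->
  (alpha - beta) * (u n)%:~R = alpha ^+ n - beta ^+ n.
Proof.
move=> hu hs hp; have [_ u0 u1 _] := hu.
suff [//] : (alpha - beta) * (u n)%:~R = alpha ^+ n - beta ^+ n /\
  (alpha - beta) * (u n.+1)%:~R = alpha ^+ n.+1 - beta ^+ n.+1.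
elim: n => [|n [IH0 IH1]].
  by rewrite u0 u1 !expr0 !expr1 mulr0 mulr1 subrr.
split=> //; rewrite (lucasS _ hu) intrD !intrM -hs -[a2%:~R]opprK -hp.
transitivity ((alpha + beta) * ((alpha - beta) * (u n.+1)%:~R)
   - alpha * beta * ((alpha - beta) * (u n)%:~R)); first by ring.
by rewrite IH0 IH1 !exprS; ring.
Qed.

Lemma lucas_roots (F : closedFieldType) (a1 a2 : int) :
  exists alpha beta : F, [/\ alpha + beta = a1%:~R, alpha * beta = - a2%:~R,
    (alpha - beta) ^+ 2 = (lucas_discr a1 a2)%:~R,
    root (map_poly intr (lucas_char_poly a1 a2)) alpha &
    root (map_poly intr (lucas_char_poly a1 a2)) beta].
Proof.
have [alpha ha] := @solve_monicpoly F 2 (nth 0 [:: a2%:~R; a1%:~R]) isT.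
move: ha; rewrite 2!big_ord_recl big_ord0 /= expr0 mulr1 expr1 addr0 => ha.
exists alpha, (a1%:~R - alpha).
have rE (x : F) : root (map_poly intr (lucas_char_poly a1 a2)) x =
    (x ^+ 2 - a1%:~R * x - a2%:~R == 0).
  rewrite /root /lucas_char_poly !rmorphB !rmorphM /= map_polyX.
  by rewrite !map_polyC /= !hornerE.
split.
- by ring.
- by rewrite mulrBr -expr2 ha; ring.
- rewrite /lucas_discr intrD intrM rmorphXn /=.
  transitivity (4 * alpha ^+ 2 - 4 * a1%:~R * alpha + a1%:~R ^+ 2 : F); first by ring.
  by rewrite ha; ring.
- by rewrite rE ha; apply/eqP; ring.
- rewrite rE; apply/eqP.
  transitivity (alpha ^+ 2 - a1%:~R * alpha - a2%:~R : F); first by ring.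
  by rewrite ha; ring.
Qed.

(** u_n = 0 would make the ratio of the two roots an n-th root of unity. *)
Lemma lucas_neq0 (R : realType) (a1 a2 : int) (u : nat -> int) (n : nat) :
  lucas_sequence a1 a2 u -> lucas_nondegenerate R a1 a2 ->
  lucas_discr a1 a2 != 0 -> (0 < n)%N -> u n != 0.
Proof.
move=> hu hnd hD n0; apply/eqP => un0.
have [a20 _ _ _] := hu.
have [al [be [hs hp hd ra rb]]] := lucas_roots R[i] a1 a2.
have := lucas_binet n hu hs hp; rewrite un0 mulr0 => /esym /eqP; rewrite subr_eq0 => /eqP E.
have be0 : be != 0.
  apply/eqP => b0; move: hp; rewrite b0 mulr0 => /esym /eqP.
  by rewrite oppr_eq0 intr_eq0 (negbTE a20).
have ab : al != be.
  apply/eqP => ab; move: hd; rewrite ab subrr expr2 mulr0 => /esym /eqP.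
  by rewrite intr_eq0 (negbTE hD).
apply: (hnd _ _ ra rb ab); exists n => //.
by rewrite unity_rootE expr_div_n E divff // expf_neq0.
Qed.

Lemma intr_eq0_pchar (p : nat) (F : nzRingType) (m : int) : p \in [pchar F] ->
  (m%:~R == 0 :> F) = (p %| `|m|)%N.
Proof. by move=> hp; rewrite -(dvdz_pcharf hp). Qed.

(** If p divides neither a2 nor the discriminant, the two distinct roots of the
    characteristic polynomial in an algebraic closure of F_p are fixed or
    exchanged by Frobenius, which gives p | u_(p-1), respectively p | u_(p+1). *)
Lemma lucas_prime_dvd (a1 a2 : int) (u : nat -> int) (p : nat) :
  lucas_sequence a1 a2 u -> prime p ->
  ~~ (p %| `|a2|)%N -> ~~ (p %| `|lucas_discr a1 a2|)%N ->
  (p %| `|u p.-1|)%N || (p %| `|u p.+1|)%N.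
Proof.
move=> hu p_pr pa2 pD.
have [K [f _]] := countable_algebraic_closure 'F_p.
have pK : p \in [pchar K] by rewrite (fmorph_pchar f) pchar_Fp.
pose FK : closedFieldType := K.
have pFK : p \in [pchar FK] by [].
have [al [be [hs hp hd _ _]]] := lucas_roots FK a1 a2.
have B n := lucas_binet n hu hs hp.
have ab0 : al - be != 0.
  apply/eqP => ab; move: hd; rewrite ab expr2 mulr0 => /esym /eqP.
  by rewrite (intr_eq0_pchar _ pFK) (negbTE pD).
have prod0 : al * be != 0.
  by rewrite hp oppr_eq0 (intr_eq0_pchar _ pFK).
have /andP[al0 be0] : (al != 0) && (be != 0) by rewrite -negb_or -mulf_eq0.
have Fint (m : int) : (m%:~R : FK) ^+ p = m%:~R.
  by rewrite -(pFrobenius_autE pFK) rmorph_int.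
have FS : al ^+ p + be ^+ p = al + be.
  by rewrite -!(pFrobenius_autE pFK) -rmorphD /= hs pFrobenius_autE Fint.
have FP : al ^+ p * be ^+ p = al * be.
  rewrite -!(pFrobenius_autE pFK) -rmorphM /= hp pFrobenius_autE.
  by rewrite -mulrNz Fint.
have p1 : p = p.-1.+1 by rewrite prednK ?prime_gt0.
(* The p-th power of alpha is again a root of the characteristic polynomial. *)
have : (al ^+ p - al) * (al ^+ p - be) = 0.
  transitivity (al ^+ p ^+ 2 - (al + be) * al ^+ p + al * be); first by ring.
  by rewrite -FS -FP; ring.
move/eqP; rewrite mulf_eq0 !subr_eq0 => /orP[/eqP h|/eqP h]; apply/orP.
- left; rewrite -(intr_eq0_pchar _ pFK); apply/eqP/(mulfI ab0); rewrite B mulr0.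
  have h' : be ^+ p = be by move: FS; rewrite h => /addrI.
  have -> : al ^+ p.-1 = 1 by apply: (mulfI al0); rewrite -exprS -p1 mulr1.
  have -> : be ^+ p.-1 = 1 by apply: (mulfI be0); rewrite -exprS -p1 mulr1.
  by rewrite subrr.
- right; rewrite -(intr_eq0_pchar _ pFK); apply/eqP/(mulfI ab0); rewrite B mulr0.
  have h' : be ^+ p = al.
    by move: FS; rewrite h [al + be]addrC => /addrI.
  by rewrite !exprS h h' mulrC subrr.
Qed.

Lemma lucas_add (a1 a2 : int) (u : nat -> int) (m n : nat) :
  lucas_sequence a1 a2 u ->
  u (m + n).+1 = u m.+1 * u n.+1 + a2 * u m * u n.
Proof.
move=> hu; have [_ u0 u1 _] := hu.
elim: m n => [|m IH] n; first by rewrite add0n u0 u1; ring.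
by rewrite addSnnS IH !(lucasS _ hu); ring.
Qed.

Lemma lucas_consecutive_ndvd (a1 a2 : int) (u : nat -> int) (p n : nat) :
  lucas_sequence a1 a2 u -> prime p -> ~~ (p %| `|a2|)%N ->
  (p %| `|u n|)%N -> (p %| `|u n.+1|)%N -> False.
Proof.
move=> hu p_pr pa2; have [_ u0 u1 _] := hu.
elim: n => [|n IH] h0 h1.
  by move: h1; rewrite u1 dvdn1 => /eqP p1; rewrite p1 in p_pr.
apply: IH => //; move: h1; rewrite (lucasS _ hu) => h1.
have : (p%:Z %| a2 * u n)%Z.
  have -> : a2 * u n = (a1 * u n.+1 + a2 * u n) - a1 * u n.+1 by ring.
  by apply: rpredB => //; apply: dvdz_mull.
by rewrite dvdzE abszM /= Euclid_dvdM // (negbTE pa2).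
Qed.

(** The rank of appearance of p: the least z > 0 with p | u_z, which divides every
    n with p | u_n, and divides p - 1 or p + 1. *)
Lemma lucas_rank_exists (a1 a2 : int) (u : nat -> int) (p : nat) :
  lucas_sequence a1 a2 u -> prime p ->
  ~~ (p %| `|a2|)%N -> ~~ (p %| `|lucas_discr a1 a2|)%N ->
  exists z : nat, [/\ (0 < z)%N, (p %| `|u z|)%N,
    (forall n, (p %| `|u n|)%N -> (z %| n)%N) &
    (z %| p.-1)%N || (z %| p.+1)%N].
Proof.
move=> hu p_pr pa2 pD; have [_ u0 u1 _] := hu.
have pm := lucas_prime_dvd hu p_pr pa2 pD.
have ex : exists n, (0 < n)%N && (p %| `|u n|)%N.
  have p1 : (0 < p.-1)%N by have := prime_gt1 p_pr; clear; lia.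
  by case/orP: pm => h; [exists p.-1; rewrite p1|exists p.+1].
case: (ex_minnP ex) => z /andP[z0 pz] zmin; exists z.
have hdvd n : (p %| `|u n|)%N -> (z %| n)%N.
  have [m] := ubnP n; elim: m n => // m IH n nm pn.
  case: n nm pn => [|n] nm pn; first by rewrite dvdn0.
  have zn : (z <= n.+1)%N by apply: zmin; rewrite pn.
  rewrite -(subnK zn) dvdn_addl ?dvdnn //; apply: IH.
    by move: nm z0 zn; clear; lia.
  (* Modulo p, the addition formula at z + (n + 1 - z) leaves only the term in
     u_(z-1), and u_(z-1) is a unit. *)
  have E : n.+1 = (z.-1 + (n.+1 - z)).+1 by move: z0 zn; clear; lia.
  have zS : z.-1.+1 = z by rewrite prednK.
  have : (p%:Z %| a2 * u z.-1 * u (n.+1 - z)%N)%Z.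
    have -> : a2 * u z.-1 * u (n.+1 - z)%N =
        u n.+1 - u z * u (n.+1 - z).+1.
      by rewrite {2}E (lucas_add _ _ hu) zS; ring.
    by apply: rpredB => //; apply: dvdz_mulr.
  rewrite dvdzE !abszM /= !Euclid_dvdM // (negbTE pa2) /= => /orP[h|//].
  by case: (lucas_consecutive_ndvd hu p_pr pa2 h); rewrite zS.
by split=> //; case/orP: pm => /hdvd ->; rewrite ?orbT.
Qed.

Lemma lucas_abs_bound (a1 a2 : int) (u : nat -> int) :
  lucas_sequence a1 a2 u ->
  exists C : nat, forall n, (`|u n| <= 2 ^ (C * n))%N.
Proof.
move=> hu; have [_ u0 u1 _] := hu.
exists (`|a1| + `|a2|).+1%N => n.
set C := (_ + _).+1%N.
suff [//] : (`|u n| <= 2 ^ (C * n))%N /\ (`|u n.+1| <= 2 ^ (C * n.+1))%N.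
elim: n => [|n [IH0 IH1]]; first by rewrite u0 u1 muln0 expn_gt0.
split=> //; rewrite (lucasS _ hu).
have le01 : (2 ^ (C * n) <= 2 ^ (C * n.+1))%N by rewrite leq_exp2l // leq_mul2l leqnSn orbT.
apply: (@leq_trans (`|a1| * `|u n.+1| + `|a2| * `|u n|)%N).
  by rewrite -!abszM -lez_nat PoszD !abszE ler_normD.
apply: (@leq_trans (C * 2 ^ (C * n.+1))%N).
  apply: (@leq_trans ((`|a1| + `|a2|) * 2 ^ (C * n.+1))%N).
    rewrite mulnDl leq_add // leq_mul //; exact: leq_trans IH0 le01.
  by rewrite leq_mul // leqnSn.
rewrite [(C * n.+2)%N]mulnS expnD leq_mul2r; apply/orP; right.
exact: (ltnW (ltn_expl _ _)).
Qed.

Lemma exp2_size_primes (m : nat) : (0 < m)%N -> (2 ^ size (primes m) <= m)%N.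
Proof.
move=> m0; rewrite {2}(prod_prime_decomp m0) prime_decompE big_map /=.
have : all (fun p => 2 <= p ^ logn p m)%N (primes m).
  apply/allP => p pm; have := pm; rewrite -logn_gt0 => l0.
  move: pm; rewrite mem_primes => /and3P[p_pr _ _].
  exact: leq_trans (prime_gt1 p_pr) (leq_pexp2l (prime_gt0 p_pr) l0).
elim: (primes m) => [|p s IH]; first by rewrite big_nil.
by rewrite /= big_cons expnS => /andP[h /IH]; apply: leq_mul.
Qed.

(** * Elementary sums *)

Lemma sum_multiples (V : nmodType) (a N : nat) (P : pred nat) (F : nat -> V) :
  (0 < a)%N ->
  \sum_(1 <= n < N.+1 | (a %| n)%N && P n) F n =
  \sum_(1 <= m < (N %/ a).+1 | P (a * m)%N) F (a * m)%N.
Proof.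
move=> a0; elim: N => [|N IH]; first by rewrite div0n !big_geq.
rewrite big_mkcond big_nat_recr //= -big_mkcond /= IH divnS //.
case: (boolP (a %| N.+1)%N) => h /=; last by rewrite addr0.
rewrite [RHS]big_mkcond big_nat_recr //= -big_mkcond /=.
have E : (a * (1 + N %/ a) = N.+1)%N.
  by rewrite -[RHS](divnK h) divnS // h mulnC.
by rewrite E.
Qed.

Lemma ler_sum_subset (R : numDomainType) (m n : nat) (P Q : pred nat) (F G : nat -> R) :
  (forall i, (m <= i < n)%N -> P i -> Q i /\ F i <= G i) ->
  (forall i, (m <= i < n)%N -> Q i -> 0 <= G i) ->
  \sum_(m <= i < n | P i) F i <= \sum_(m <= i < n | Q i) G i.
Proof.
move=> h1 h2; rewrite big_mkcond [leRHS]big_mkcond /= big_nat_cond [leRHS]big_nat_cond.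
apply: ler_sum => i; rewrite andbT => hi.
case: (boolP (P i)) => Pi; first by have [-> ] := h1 i hi Pi.
by case: (boolP (Q i)) => // Qi; apply: h2.
Qed.

Lemma count_multiples_le (R : realFieldType) (a N : nat) : (0 < a)%N ->
  \sum_(1 <= n < N.+1 | (a %| n)%N) (1 : R) <= N%:R / a%:R.
Proof.
move=> a0.
have -> : \sum_(1 <= n < N.+1 | (a %| n)%N) (1 : R) =
    \sum_(1 <= n < N.+1 | (a %| n)%N && xpredT n) (1 : R).
  by apply: eq_bigl => n; rewrite andbT.
rewrite sum_multiples // big_const_nat subSS subn0 iter_addr_0.
rewrite ler_pdivlMr ?ltr0n // -natrM ler_nat; exact: leq_divM.
Qed.

Lemma sum_divisors (V : nmodType) (d D : nat) (F : nat -> V) :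
  (0 < d <= D)%N ->
  \sum_(e <- divisors d) F e = \sum_(1 <= e < D.+1 | (e %| d)%N) F e.
Proof.
move=> /andP[d0 dD]; rewrite -[RHS]big_filter; apply: perm_big; apply: uniq_perm.
- exact: divisors_uniq.
- by rewrite filter_uniq // iota_uniq.
move=> e; rewrite mem_filter mem_index_iota -dvdn_divisors //.
case: (boolP (e %| d)%N) => //= ed.
by rewrite (dvdn_gt0 d0 ed) ltnS (leq_trans (dvdn_leq d0 ed) dD).
Qed.

Lemma size_divisors_dvd (d m : nat) : (0 < m)%N -> (d %| m)%N ->
  (size (divisors d) <= size (divisors m))%N.
Proof.
move=> m0 dm; apply: uniq_leq_size; first exact: divisors_uniq.
move=> e; rewrite -!dvdn_divisors ?(dvdn_gt0 m0 dm) // => ed.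
exact: dvdn_trans dm.
Qed.

(** The harmonic sum. *)
Definition hsum (R : realType) (N : nat) : R := \sum_(1 <= n < N.+1) n%:R^-1.

Lemma hsum_ge0 (R : realType) (N : nat) : 0 <= hsum R N.
Proof. by apply: sumr_ge0 => i _; rewrite invr_ge0 ler0n. Qed.

Lemma hsum_le_ln (R : realType) (N : nat) : (0 < N)%N -> hsum R N <= 1 + ln N%:R.
Proof.
case: N => // N _; elim: N => [|N IH].
  by rewrite /hsum big_nat1 ln1 addr0 invr1.
rewrite /hsum big_nat_recr //=.
apply: le_trans (lerD IH (lexx _)) _.
rewrite -addrA lerD2l -lerBrDl.
have p1 : (0 : R) < N.+1%:R by rewrite ltr0n.
have p2 : (0 : R) < N.+2%:R by rewrite ltr0n.
have -> : ln (N.+2%:R : R) - ln N.+1%:R = - ln (N.+1%:R / N.+2%:R : R).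
  by rewrite ln_div ?posrE //; ring.
rewrite lerNr.
have -> : N.+1%:R / N.+2%:R = 1 + (- N.+2%:R^-1) :> R.
  have E : N.+2%:R = N.+1%:R + 1 :> R by rewrite natr1.
  rewrite E in p2 *; move: p1 p2; move: (N.+1%:R) => a p1 p2; field; lra.
apply: le_ln1Dx; rewrite ltrN2 invf_lt1 // ltr1n //.
Qed.

(** The sum of tau(d) / d up to D is at most the square of the harmonic sum. *)
Lemma sum_divisors_count_le (R : realType) (D : nat) :
  \sum_(1 <= d < D.+1) (size (divisors d))%:R / d%:R <= hsum R D ^+ 2.
Proof.
have -> : \sum_(1 <= d < D.+1) (size (divisors d))%:R / d%:R =
    \sum_(1 <= d < D.+1) \sum_(1 <= e < D.+1) if (e %| d)%N then d%:R^-1 else 0 :> R.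
  apply: eq_big_nat => d hd; rewrite -big_mkcond /= -(sum_divisors (fun=> d%:R^-1)) //.
  rewrite big_const_seq count_predT iter_addr_0 -[RHS]mulr_natl //.
rewrite exchange_big /= expr2 {1}/hsum mulr_suml.
rewrite big_nat_cond [leRHS]big_nat_cond; apply: ler_sum => e; rewrite andbT => /andP[e0 eD].
rewrite -big_mkcond /=.
have -> : \sum_(1 <= d < D.+1 | (e %| d)%N) d%:R^-1 =
    \sum_(1 <= d < D.+1 | (e %| d)%N && xpredT d) d%:R^-1 :> R.
  by apply: eq_bigl => d; rewrite andbT.
rewrite sum_multiples // /hsum mulr_sumr.
under eq_bigr do rewrite natrM invfM.
rewrite [leRHS](@big_cat_nat _ _ _ (D %/ e).+1) //=; last by rewrite ltnS leq_div.
by rewrite lerDl sumr_ge0 // => i _; rewrite mulr_ge0 // invr_ge0 ler0n.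
Qed.

(** * Reciprocals of primes *)

(** The sum of 1/q over the primes q up to N. *)
Definition prime_hsum (R : realType) (N : nat) : R :=
  \sum_(1 <= q < N.+1 | prime q) q%:R^-1.

Lemma prime_hsum_le (R : realType) (M N : nat) : (M <= N)%N ->
  prime_hsum R M <= prime_hsum R N.
Proof.
move=> MN; rewrite /prime_hsum [leRHS](@big_cat_nat _ _ _ M.+1) //=.
by rewrite lerDl sumr_ge0 // => i _; rewrite invr_ge0 ler0n.
Qed.

Lemma prod_primes_dvd (s : seq nat) (m : nat) :
  uniq s -> all (fun p => prime p && (p %| m)%N) s -> (\prod_(p <- s) p %| m)%N.
Proof.
elim: s => [|p s IH] /=; first by rewrite big_nil dvd1n.
move=> /andP[ps us] /andP[/andP[p_pr pm] hs].
rewrite big_cons Gauss_dvd ?pm ?IH //.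
rewrite prime_coprime // Euclid_dvd_prod // big_has; apply/hasPn => q qs.
have /andP[q_pr _] := allP hs q qs.
by rewrite dvdn_prime2 //; apply: contraNneq ps => ->.
Qed.

Lemma bin_le_exp2 (n m : nat) : ('C(n, m) <= 2 ^ n)%N.
Proof.
elim: n m => [|n IH] [|m]; rewrite ?bin0 ?bin0n ?expn_gt0 //.
by rewrite binS expnS mul2n -addnn leq_add.
Qed.

Lemma prime_dvd_fact (p n : nat) : prime p -> (p %| n`!)%N -> (p <= n)%N.
Proof.
move=> p_pr; rewrite fact_prod Euclid_dvd_prod // big_has.
case/hasP=> i; rewrite mem_index_iota => /andP[i0 iN] /(dvdn_leq i0) pi.
exact: leq_trans pi iN.
Qed.

(** Chebyshev's bound: all primes in (n, 2n] divide the binomial coefficient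
    of 2n over n, which is at most 4 ^ n. *)
Lemma count_primes_double (n : nat) :
  (n ^ (count prime (index_iota n.+1 (2 * n).+1)) <= 2 ^ (2 * n))%N.
Proof.
set s := [seq q <- index_iota n.+1 (2 * n).+1 | prime q].
have -> : count prime (index_iota n.+1 (2 * n).+1) = size s by rewrite size_filter.
apply: (@leq_trans (\prod_(q <- s) q)%N).
  have : all (fun q => n <= q)%N s.
    apply/allP => q; rewrite mem_filter mem_index_iota => /andP[_ /andP[h _]].
    exact: ltnW.
  elim: (s) => [|q t IH] /=; first by rewrite big_nil.
  by move=> /andP[nq /IH]; rewrite big_cons expnS; apply: leq_mul.
apply: leq_trans (bin_le_exp2 (2 * n) n).
apply: dvdn_leq; first by rewrite bin_gt0; lia.
apply: prod_primes_dvd; first by rewrite filter_uniq // iota_uniq.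
apply/allP => q; rewrite mem_filter mem_index_iota => /andP[q_pr /andP[nq q2n]].
rewrite q_pr /=.
have h : (q %| (2 * n)`!)%N by rewrite dvdn_fact // prime_gt0.
have nn : (n <= 2 * n)%N by lia.
have nqf : (q %| n`!)%N = false.
  by apply/negP => /(prime_dvd_fact q_pr); rewrite leqNgt nq.
move: h; rewrite -(bin_fact nn) !Euclid_dvdM //.
have -> : (2 * n - n = n)%N by lia.
by rewrite nqf !orbF.
Qed.

Lemma prime_hsum_exp2 (R : realType) (K : nat) :
  prime_hsum R (2 ^ K.+1) <= 2^-1 + 2 * hsum R K.
Proof.
elim: K => [|K IH].
  rewrite /hsum big_geq // mulr0 addr0 /prime_hsum expn1.
  by rewrite big_mkcond big_nat_recr //= big_nat1 /= add0r.
rewrite /hsum big_nat_recr //= -/(hsum R K) mulrDr addrA.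
rewrite /prime_hsum (@big_cat_nat _ _ _ (2 ^ K.+1).+1) //=; last first.
  by rewrite ltnS leq_exp2l.
rewrite -/(prime_hsum R _); apply: lerD => //.
set n := (2 ^ K.+1)%N.
have -> : (2 ^ K.+2 = 2 * n)%N by rewrite expnS.
have n0 : (0 < n)%N by rewrite expn_gt0.
set c := count prime (index_iota n.+1 (2 * n).+1).
apply: (@le_trans _ _ (c%:R / n%:R)).
  rewrite /c -sum1_count natr_sum mulr_suml.
  rewrite big_nat_cond [leRHS]big_nat_cond; apply: ler_sum => q /andP[/andP[nq _] _].
  rewrite mul1r lef_pV2 ?posrE ?ltr0n //; first by rewrite ler_nat ltnW.
  exact: leq_ltn_trans nq.
have := count_primes_double n; rewrite -/c {1}/n -expnM leq_exp2l // => h.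
rewrite ler_pdivrMr ?ltr0n // -mulrA mulrC -mulrA ler_pdivlMl ?ltr0n //.
by rewrite -!natrM ler_nat; lia.
Qed.

Lemma ln2_ge (R : realType) : 2^-1 <= ln (2 : R).
Proof.
have : ln (1 + (- 2^-1)) <= - 2^-1 :> R by apply: le_ln1Dx; lra.
have -> : 1 + (- 2^-1) = 2^-1 :> R by lra.
by rewrite lnV ?posrE // lerN2.
Qed.

(** An explicit form of the upper bound in Mertens' second theorem. *)
Lemma prime_hsum_le_lnln (R : realType) (x : R) : 1 <= ln x ->
  prime_hsum R (Num.truncn x) <= 5 + 2 * ln (ln x).
Proof.
move=> l1.
have x0 : 0 < x by rewrite ltNge; apply/negP => /ln0 h; move: l1; rewrite h; lra.
have x2 : 2 <= x.
  have : expR 1 <= x by rewrite -[leRHS]lnK ?posrE // ler_expR.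
  have := expR_ge1Dx (1 : R); lra.
set N := Num.truncn x.
have N2 : (2 <= N)%N by rewrite truncn_ge_nat // ltW.
have N0 : (0 < N)%N by apply: leq_trans N2.
have /andP[K1 K2] := trunc_log_bounds (isT : (1 < 2)%N) N0.
set K := trunc_log 2 N in K1 K2.
have K0 : (0 < K)%N.
  by rewrite lt0n; apply: contraTneq K2 => ->; rewrite -leqNgt.
apply: le_trans (prime_hsum_le _ (ltnW K2)) _.
apply: le_trans (prime_hsum_exp2 _ _) _.
have Kx : (2 : R) ^+ K <= x.
  rewrite -natrX; apply: (@le_trans _ _ N%:R); first by rewrite ler_nat.
  by rewrite truncn_le ltW.
have Kl : K%:R * ln 2 <= ln x.
  by rewrite mulr_natl -lnXn // ler_ln ?posrE ?exprn_gt0.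
have K2l : K%:R <= 2 * ln x.
  have := ln2_ge R; have : 0 <= K%:R :> R by rewrite ler0n.
  nra.
have : ln (K%:R : R) <= 1 + ln (ln x).
  apply: (@le_trans _ _ (ln (2 * ln x))); first by rewrite ler_ln ?posrE ?ltr0n //; lra.
  rewrite lnM ?posrE //; last lra.
  rewrite lerD2r; have := @le_ln1Dx R 1; rewrite (_ : 1 + 1 = 2) //; apply; lra.
have := hsum_le_ln R K0; lra.
Qed.

(** * Smooth numbers *)

(** All prime factors of n are at most y (for n > 0; 0 counts as smooth). *)
Definition smooth (y n : nat) : bool := all (fun p => p <= y)%N (primes n).

Lemma smoothP (y n : nat) : (0 < n)%N ->
  reflect (forall p, prime p -> (p %| n)%N -> (p <= y)%N) (smooth y n).
Proof.
move=> n0; apply: (iffP allP) => h p.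
  by move=> p_pr pn; apply: h; rewrite mem_primes p_pr n0.
by rewrite mem_primes => /and3P[p_pr _ pn]; apply: h.
Qed.

Lemma smooth_dvd (y m n : nat) : (0 < n)%N -> (m %| n)%N ->
  smooth y n -> smooth y m.
Proof.
move=> n0 mn /(smoothP _ n0) h; apply/(smoothP _ (dvdn_gt0 n0 mn)) => p p_pr pm.
by apply: h => //; apply: dvdn_trans mn.
Qed.

Lemma smooth_max_pdiv (y n : nat) : (1 < n)%N -> smooth y n = (max_pdiv n <= y)%N.
Proof.
move=> n1; have n0 : (0 < n)%N by apply: ltnW.
apply/(smoothP _ n0)/idP => [h|h p p_pr pn].
  by apply: h; rewrite ?max_pdiv_prime ?max_pdiv_dvd.
by apply: leq_trans h; apply: max_pdiv_max; rewrite mem_primes p_pr n0.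
Qed.

(** The partial Euler product bounds sums over smooth numbers: split off the
    multiples of the largest admissible prime and solve the resulting
    inequality. *)
Lemma sum_smooth_le_prod (R : realFieldType) (f : nat -> R) (y N : nat) :
  (forall n, 0 <= f n) -> f 1%N <= 1 -> (forall m n, f (m * n)%N = f m * f n) ->
  (forall q, (2 <= q)%N -> f q < 1) ->
  \sum_(1 <= n < N.+1 | smooth y n) f n <= \prod_(1 <= q < y.+1 | prime q) (1 - f q)^-1.
Proof.
move=> f0 f1 fM flt; elim: y => [|y IH].
  rewrite [leRHS]big_geq //.
  case: N => [|N]; first by rewrite big_geq // ler01.
  rewrite big_mkcond big_nat_recl //= big_nat_cond big1 ?addr0 //.
  move=> i /andP[/andP[i0 iN] _]; rewrite smooth_max_pdiv ?ltnS //.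
  by rewrite leqNgt max_pdiv_gt0.
set A := \sum_(_ <= _ < _ | smooth y.+1 _) _.
rewrite [leRHS]big_mkcond big_nat_recr //= -big_mkcond /=.
case: ifP => yp; last first.
  rewrite mulr1; apply: le_trans IH; rewrite /A.
  apply: ler_sum_subset => // i /andP[i0 _] /(smoothP _ i0) h.
  split=> //; apply/(smoothP _ i0) => p p_pr pi; have := h p p_pr pi.
  by rewrite leq_eqVlt => /orP[/eqP py|//]; rewrite -py p_pr in yp.
set q := y.+1 in yp A *.
have q2 : (2 <= q)%N by apply: prime_gt1.
rewrite ler_pdivlMr ?subr_gt0 ?flt // mulrBr mulr1 lerBlDr.
apply: le_trans (lerD IH (lexx _)).
rewrite {1}/A (bigID (fun n => ~~ (q %| n)%N)) /=; apply: lerD.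
  apply: ler_sum_subset => // i /andP[i0 _] /andP[/(smoothP _ i0) h qi].
  split=> //; apply/(smoothP _ i0) => p p_pr pi; have := h p p_pr pi.
  by rewrite leq_eqVlt => /orP[/eqP py|//]; rewrite -/q -py pi in qi.
under eq_bigl => n do rewrite negbK andbC.
rewrite sum_multiples; last by apply: ltnW.
under eq_bigr do rewrite fM.
rewrite -mulr_sumr mulrC ler_wpM2r // /A.
rewrite [leRHS]big_mkcond [leRHS](@big_cat_nat _ _ _ (N %/ q).+1) //=; last first.
  by rewrite ltnS leq_div.
rewrite -[leLHS]addr0; apply: lerD; last first.
  by apply: sumr_ge0 => i _; case: ifP.
rewrite -big_mkcond /=; apply: ler_sum_subset => // i /andP[i0 _] h.
by split=> //; apply: smooth_dvd h; rewrite ?dvdn_mull // muln_gt0 i0 ltnW.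
Qed.

Lemma inv1B_le_exp (R : realType) (t : R) : 0 <= t -> t <= 3 / 4 ->
  (1 - t)^-1 <= expR (4 * t).
Proof.
move=> t0 t1; rewrite -[leLHS]mul1r ler_pdivrMr; last lra.
have := expR_ge1Dx (4 * t); nra.
Qed.

(** Rankin's bound for the number of smooth numbers up to X: each m <= X is
    weighted by (X / m) ^ (1 - eta) >= 1. *)
Lemma rankin_bound (R : realType) (X eta M : R) (y N : nat) :
  0 < X -> (forall m, (m <= N)%N -> m%:R <= X) ->
  0 <= eta -> eta <= 2^-1 -> y%:R `^ eta <= M ->
  \sum_(1 <= m < N.+1 | smooth y m) 1 <=
    X `^ (1 - eta) * expR (4 * M * prime_hsum R y).
Proof.
move=> X0 NX eta0 eta1 yM.
pose f (n : nat) : R := n%:R `^ (eta - 1).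
have f0 n : 0 <= f n by apply: powR_ge0.
have fq q : (0 < q)%N -> f q = q%:R `^ eta / q%:R.
  move=> q0; rewrite /f powRB ?powRr1 ?ler0n //.
  by apply/implyP => _; rewrite pnatr_eq0 -lt0n.
have fle q : (2 <= q)%N -> f q <= 3 / 4.
  move=> q2; apply: (@le_trans _ _ (q%:R `^ (- 2^-1))).
    apply: ler_powR; first by rewrite ler1n ltnW.
    lra.
  rewrite powRN powR12_sqrt ?ler0n //.
  have s2 : (4 / 3 : R) <= Num.sqrt q%:R.
    rewrite -(@ler_pXn2r _ 2) ?nnegrE ?sqrtr_ge0 ?divr_ge0 //.
    rewrite sqr_sqrtr ?ler0n //; apply: (@le_trans _ _ 2); first lra.
    by rewrite ler_nat.
  by rewrite -[3 / 4]invrK lef_pV2 ?posrE ?invr_gt0; lra.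
apply: (@le_trans _ _ (X `^ (1 - eta) * \sum_(1 <= m < N.+1 | smooth y m) f m)).
  rewrite mulr_sumr big_nat_cond [leRHS]big_nat_cond.
  apply: ler_sum => m /andP[/andP[m0 mN] _].
  have m0' : 0 < m%:R :> R by rewrite ltr0n.
  have -> : f m = (m%:R `^ (1 - eta))^-1 by rewrite /f -powRN opprB.
  rewrite ler_pdivlMr ?powR_gt0 // mul1r.
  by apply: ge0_ler_powR; rewrite ?nnegrE ?ler0n ?(ltW X0) ?NX //; lra.
apply: ler_wpM2l; first exact: powR_ge0.
apply: (@le_trans _ _ (\prod_(1 <= q < y.+1 | prime q) (1 - f q)^-1)).
  apply: sum_smooth_le_prod => //.
  - by rewrite /f powR1.
  - by move=> m n; rewrite /f natrM powRM.
  - by move=> q /fle; lra.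
apply: (@le_trans _ _ (\prod_(1 <= q < y.+1 | prime q) expR (4 * M * q%:R^-1))).
  rewrite big_nat_cond [leRHS]big_nat_cond.
  apply: ler_prod => q /andP[/andP[q0 qy] q_pr].
  have fq34 := fle q (prime_gt1 q_pr).
  rewrite invr_ge0 subr_ge0 (le_trans fq34) /=; last lra.
  apply: le_trans (inv1B_le_exp (f0 q) fq34) _.
  rewrite ler_expR -mulrA ler_pM2l // fq // ler_wpM2r ?invr_ge0 ?ler0n //.
  apply: le_trans yM; apply: ge0_ler_powR; rewrite ?nnegrE ?ler0n ?ler_nat //.
by rewrite -expR_sum /prime_hsum mulr_sumr.
Qed.

(** * Splitting the sum according to the largest prime factor *)

Lemma sum_fiber_le (R : realFieldType) (g : nat -> nat) (l m N : nat) :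
  (0 < l)%N -> (forall n, (0 < n)%N -> g n = m -> (l %| n)%N) ->
  \sum_(1 <= n < N.+1 | m == g n) (m%:R : R) <= N%:R * (m%:R / l%:R).
Proof.
move=> l0 h; under eq_bigr do rewrite -[m%:R]mulr1.
rewrite -mulr_sumr mulrCA ler_wpM2l ?ler0n //.
apply: le_trans (count_multiples_le R N l0).
apply: ler_sum_subset => // n /andP[n0 _] /eqP gn.
by split=> //; apply: h.
Qed.

(** If g n = m, then n is a multiple of m, and even of the least common multiple
    of m and z p where p is the largest prime factor of m, provided p > Y. *)
Lemma gcd_sum_split (R : realFieldType) (g z : nat -> nat) (Y N : nat) :
  (forall n, (0 < n)%N -> (g n %| n)%N) ->
  (forall n p, (0 < n)%N -> prime p -> (Y < p)%N -> (p %| g n)%N -> (z p %| n)%N) ->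
  (forall p, prime p -> (Y < p)%N -> (0 < z p)%N) ->
  \sum_(1 <= n < N.+1) (g n)%:R <=
  N%:R * (\sum_(1 <= m < N.+1 | smooth Y m) 1 +
    \sum_(1 <= p < N.+1 | prime p && (Y < p)%N) \sum_(e <- divisors (z p))
      e%:R / (z p)%:R * \sum_(1 <= m < N.+1 | (max_pdiv m == p) && (e %| m)%N) 1) :> R.
Proof.
move=> hg hz z0.
have g0 n : (0 < n)%N -> (0 < g n)%N by move=> n0; apply: dvdn_gt0 (hg n n0).
(* N * W m bounds m times the number of n <= N with g n = m. *)
pose W m : R := if smooth Y m then 1
  else (gcdn m (z (max_pdiv m)))%:R / (z (max_pdiv m))%:R.
have nsm m : (0 < m)%N -> ~~ smooth Y m ->
    [/\ (1 < m)%N, prime (max_pdiv m) & (Y < max_pdiv m)%N].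
  move=> m0 sm.
  have m1 : (1 < m)%N.
    by rewrite ltn_neqAle m0 andbT; apply: contraNneq sm => <-.
  by move: sm; rewrite smooth_max_pdiv // -ltnNge => sm; rewrite max_pdiv_prime.
have step1 : \sum_(1 <= n < N.+1) (g n)%:R <= \sum_(1 <= m < N.+1) N%:R * W m :> R.
  have -> : \sum_(1 <= n < N.+1) (g n)%:R =
      \sum_(1 <= n < N.+1) \sum_(1 <= m < N.+1) if m == g n then m%:R else 0 :> R.
    apply: eq_big_nat => n /andP[n0 nN]; rewrite -big_mkcond /= big_nat1_eq.
    by rewrite g0 // ltnS (leq_trans (dvdn_leq n0 (hg n n0)) nN).
  rewrite exchange_big /= big_nat_cond [leRHS]big_nat_cond.
  apply: ler_sum => m; rewrite andbT => /andP[m0 mN].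
  rewrite -big_mkcond /= /W; case: ifP => sm.
    rewrite -[X in _ <= _ * X](@divff _ m%:R) ?pnatr_eq0 -?lt0n //.
    by apply: sum_fiber_le => // n n0 <-; apply: hg.
  have [m1 P_pr YP] := nsm m m0 (negbT sm).
  set P := max_pdiv m in P_pr YP *.
  have zP := z0 P P_pr YP.
  have l0 : (0 < lcmn m (z P))%N by rewrite lcmn_gt0 m0.
  have -> : (gcdn m (z P))%:R / (z P)%:R = m%:R / (lcmn m (z P))%:R :> R.
    apply/eqP; rewrite eqr_div ?pnatr_eq0 -?lt0n // -!natrM eqr_nat.
    by rewrite mulnC muln_lcm_gcd.
  apply: sum_fiber_le => // n n0 gn; rewrite dvdn_lcm -{1}gn hg //=.
  by apply: hz => //; rewrite gn max_pdiv_dvd.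
apply: le_trans step1 _; rewrite -mulr_sumr ler_wpM2l ?ler0n //.
rewrite (bigID (smooth Y)) /=; apply: lerD.
  by apply: ler_sum => m sm; rewrite /W sm.
pose B p m : R := \sum_(e <- divisors (z p) | (e %| m)%N) e%:R / (z p)%:R.
have B0 p m : 0 <= B p m by apply: sumr_ge0 => e _; rewrite divr_ge0 ?ler0n.
have -> : \sum_(1 <= p < N.+1 | prime p && (Y < p)%N) \sum_(e <- divisors (z p))
      e%:R / (z p)%:R * \sum_(1 <= m < N.+1 | (max_pdiv m == p) && (e %| m)%N) 1 =
    \sum_(1 <= p < N.+1 | prime p && (Y < p)%N)
      \sum_(1 <= m < N.+1) if max_pdiv m == p then B p m else 0 :> R.
  apply: eq_bigr => p _.
  under eq_bigr do rewrite mulr_sumr big_mkcond /=.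
  rewrite exchange_big /=; apply: eq_bigr => m _.
  case: eqP => _ /=; last by rewrite big1.
  by rewrite -big_mkcond /= /B; apply: eq_bigr => e _; rewrite mulr1.
rewrite exchange_big /= big_mkcond /= big_nat_cond [leRHS]big_nat_cond.
apply: ler_sum => m; rewrite andbT => /andP[m0 mN].
case: ifP => sm; last by apply: sumr_ge0 => p _; case: ifP.
have [m1 P_pr YP] := nsm m m0 sm.
set P := max_pdiv m in P_pr YP *.
have zP := z0 P P_pr YP.
have PN : (1 <= P < N.+1)%N.
  by rewrite prime_gt0 //=; apply: leq_ltn_trans mN; rewrite max_pdiv_leq.
rewrite big_mkcond (bigD1_seq P) ?mem_index_iota ?iota_uniq //=.
rewrite P_pr YP eqxx /=.
apply: (@le_trans _ _ (B P m)); last first.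
  by rewrite lerDl sumr_ge0 // => p _; case: ifP => // _; case: ifP.
(* gcd(m, z) is itself a common divisor of m and z. *)
rewrite /W (negbTE sm) -/P /B big_mkcond (bigD1_seq (gcdn m (z P))) ?divisors_uniq //=.
  rewrite dvdn_gcdl /= lerDl; apply: sumr_ge0 => e _; case: ifP => // _.
by rewrite -dvdn_divisors // dvdn_gcdr.
Qed.

(** Rankin's bound for the multiples of e with largest prime factor p: such a
    number is p * e * m with m smooth. *)
Lemma count_max_pdiv_le (R : realType) (x eta M : R) (p e N : nat) :
  0 < x -> N%:R <= x -> 0 <= eta -> eta <= 2^-1 -> p%:R `^ eta <= M ->
  prime p -> (0 < e)%N -> coprime p e ->
  \sum_(1 <= m < N.+1 | (max_pdiv m == p) && (e %| m)%N) 1 <=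
    (x / (p * e)%N%:R) `^ (1 - eta) * expR (4 * M * prime_hsum R p).
Proof.
move=> x0 Nx eta0 eta1 pM p_pr e0 cpe.
have pe0 : (0 < p * e)%N by rewrite muln_gt0 prime_gt0.
apply: (@le_trans _ _ (\sum_(1 <= m < N.+1 | (p * e %| m)%N && smooth p m) 1)).
  apply: ler_sum_subset => // m /andP[m0 mN] /andP[/eqP mp em]; split=> //.
  have m1 : (1 < m)%N.
    rewrite ltn_neqAle m0 andbT; apply: contraTneq p_pr => m1.
    by rewrite -mp -m1.
  by rewrite Gauss_dvd // em -mp max_pdiv_dvd /= smooth_max_pdiv.
rewrite sum_multiples //.
apply: (@le_trans _ _ (\sum_(1 <= m < (N %/ (p * e)).+1 | smooth p m) 1)).
  apply: ler_sum_subset => // m /andP[m0 mN] sm; split=> //.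
  by apply: smooth_dvd sm; [rewrite muln_gt0 pe0|exact: dvdn_mull].
apply: rankin_bound => //; first by rewrite divr_gt0 // ltr0n.
move=> m mN; rewrite ler_pdivlMr ?ltr0n // -natrM.
apply: le_trans Nx; rewrite ler_nat.
by apply: leq_trans (leq_divM N (p * e)); rewrite leq_mul2r mN orbT.
Qed.

(** Summed over e | z, with e <= p + 1 <= p ^ 2, Rankin's bound loses the number of
    divisors of z and the factor p ^ (3 eta). *)
Lemma weighted_count_max_pdiv_le (R : realType) (x eta M : R) (p z N : nat) :
  0 < x -> N%:R <= x -> 0 <= eta -> eta <= 2^-1 -> p%:R `^ eta <= M ->
  prime p -> (0 < z)%N -> (z <= p.+1)%N -> coprime p z ->
  \sum_(e <- divisors z) e%:R / z%:R *
      \sum_(1 <= m < N.+1 | (max_pdiv m == p) && (e %| m)%N) 1 <=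
    (size (divisors z))%:R / (z%:R * p%:R) *
      (x * x `^ (- eta) * M ^+ 3 * expR (4 * M * prime_hsum R p)).
Proof.
move=> x0 Nx eta0 eta1 pM p_pr z0 zp cpz.
have p0 : (0 < p)%N by apply: prime_gt0.
have p2 : (1 < p)%N by apply: prime_gt1.
set E := expR _.
set Q := x * _ * _ * _.
have -> : (size (divisors z))%:R / (z%:R * p%:R) * Q =
    \sum_(e <- divisors z) Q / (z%:R * p%:R).
  by rewrite big_const_seq count_predT iter_addr_0 -[RHS]mulr_natl mulrAC mulrA.
rewrite big_seq [leRHS]big_seq; apply: ler_sum => e.
rewrite -dvdn_divisors // => ez.
have e0 : (0 < e)%N := dvdn_gt0 z0 ez.
have cpe : coprime p e by apply: coprime_dvdr cpz.
have eR : 0 < e%:R :> R by rewrite ltr0n.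
have zR : 0 < z%:R :> R by rewrite ltr0n.
have pR : 0 < p%:R :> R by rewrite ltr0n.
have h := count_max_pdiv_le x0 Nx eta0 eta1 pM p_pr e0 cpe.
apply: le_trans (ler_wpM2l _ h) _; first by rewrite divr_ge0 ?ler0n.
have -> : (x / (p * e)%:R) `^ (1 - eta) =
    x / (p%:R * e%:R) * (x `^ (- eta) * (p * e)%:R `^ eta).
  rewrite powRB; last first.
    by apply/implyP => _; rewrite gt_eqF // divr_gt0 // ltr0n muln_gt0 p0.
  rewrite powRr1; last by rewrite divr_ge0 ?ler0n // ltW.
  rewrite -powRN powRM ?invr_ge0 ?ler0n ?(ltW x0) // natrM; congr (_ * (_ * _)).
  by rewrite -powR_inv1 ?mulr_ge0 ?ler0n // -powRrM mulN1r opprK.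
have pe3 : (p * e)%:R `^ eta <= M ^+ 3.
  apply: (@le_trans _ _ ((p%:R `^ eta) ^+ 3)); last first.
    by rewrite lerXn2r ?nnegrE ?powR_ge0 // (le_trans (powR_ge0 _ _) pM).
  rewrite -powR_mulrn ?powR_ge0 // powRAC powR_mulrn ?ler0n //.
  apply: ge0_ler_powR; rewrite ?nnegrE ?exprn_ge0 ?ler0n //.
  rewrite -natrX ler_nat expnS leq_mul2l; apply/orP; right.
  apply: leq_trans (dvdn_leq z0 ez) (leq_trans zp _).
  by rewrite expnS expn1; nia.
have -> : e%:R / z%:R * (x / (p%:R * e%:R) * (x `^ (- eta) * (p * e)%:R `^ eta) * E)
    = x * x `^ (- eta) * (p * e)%:R `^ eta * E / (z%:R * p%:R).
  by move: (x `^ _) ((p * e)%:R `^ eta) => a b; field; rewrite !lt0r_neq0.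
rewrite ler_wpM2r ?invr_ge0 ?mulr_ge0 ?ler0n // /Q.
rewrite ler_wpM2r ?expR_ge0 // ler_wpM2l // mulr_ge0 ?powR_ge0 // ltW //.
Qed.

Lemma dvd_prime_pm1_coprime (p z : nat) : prime p -> (z %| p.-1)%N || (z %| p.+1)%N ->
  coprime p z /\ (z <= p.+1)%N.
Proof.
move=> p_pr; have p0 := prime_gt0 p_pr; have p1 := prime_gt1 p_pr.
case/orP => h.
  split; last by apply: leq_trans (dvdn_leq _ h) _; lia.
  apply: coprime_dvdr h _; rewrite -{1}(prednK p0) coprimeSn //.
split; last exact: dvdn_leq h.
by apply: coprime_dvdr h _; rewrite coprimenS.
Qed.

(** The primes are weighted by p ^ (- 1/2) <= 1/z + z/p; for the first term
    few primes share the same z, for the second z divides p - 1 or p + 1. *)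
Lemma sum_rank_le (R : realType) (z : nat -> nat) (C : R) (Y N : nat) :
  0 <= C ->
  (forall p, prime p -> (Y < p)%N -> (0 < z p)%N /\ ((z p %| p.-1)%N || (z p %| p.+1)%N)) ->
  (forall d, (0 < d)%N ->
    \sum_(1 <= p < N.+1 | prime p && (Y < p)%N && (z p == d)) 1 <= C * d%:R) ->
  \sum_(1 <= p < N.+1 | prime p && (Y < p)%N)
     (size (divisors (z p)))%:R / ((z p)%:R * Num.sqrt p%:R)
  <= (C + 3) * hsum R N.+1 ^+ 2.
Proof.
move=> C0 hz hC.
pose t n : R := (size (divisors n))%:R.
have t0 n : 0 <= t n by apply: ler0n.
pose T : R := \sum_(1 <= d < N.+2) t d / d%:R.
have T0 : 0 <= T by apply: sumr_ge0 => d _; rewrite divr_ge0 ?ler0n.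
apply: (@le_trans _ _ ((C + 3) * T)); last first.
  by rewrite ler_wpM2l ?sum_divisors_count_le //; lra.
have amgm p : prime p -> (Y < p)%N ->
    t (z p) / ((z p)%:R * Num.sqrt p%:R) <= t (z p) / (z p)%:R ^+ 2 + t (z p) / p%:R.
  move=> p_pr Yp; have [z0 _] := hz p p_pr Yp.
  have zR : 0 < (z p)%:R :> R by rewrite ltr0n.
  have pR : 0 < p%:R :> R by rewrite ltr0n prime_gt0.
  rewrite -mulrDr ler_wpM2l //.
  have sR : 0 < Num.sqrt p%:R :> R by rewrite sqrtr_gt0.
  rewrite -{2}(sqr_sqrtr (ltW pR)).
  move: (Num.sqrt _) sR (z p)%:R zR => s s0 w w0.
  rewrite invfM -!exprVn.
  have := invr_gt0 s; have := invr_gt0 w; rewrite s0 w0.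
  move: s^-1 w^-1 => a b a0 b0; nra.
apply: (@le_trans _ _ (\sum_(1 <= p < N.+1 | prime p && (Y < p)%N)
    (t (z p) / (z p)%:R ^+ 2 + t (z p) / p%:R))).
  by apply: ler_sum => p /andP[p_pr Yp]; apply: amgm.
rewrite big_split /= mulrDl; apply: lerD.
  apply: (@le_trans _ _ (\sum_(1 <= p < N.+1 | prime p && (Y < p)%N)
     \sum_(1 <= d < N.+2) if z p == d then t d / d%:R ^+ 2 else 0)).
    rewrite big_nat_cond [leRHS]big_nat_cond.
    apply: ler_sum => p /andP[/andP[p0 pN] /andP[p_pr Yp]].
    have [z0 zd] := hz p p_pr Yp; have [_ zp] := dvd_prime_pm1_coprime p_pr zd.
    rewrite (bigD1_seq (z p)) ?iota_uniq //=.
      by rewrite eqxx lerDl sumr_ge0 // => d _; case: ifP => // _; rewrite divr_ge0 // exprn_ge0.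
    by rewrite mem_index_iota z0 /= ltnS (leq_trans zp).
  rewrite exchange_big /= /T mulr_sumr big_nat_cond [leRHS]big_nat_cond.
  apply: ler_sum => d; rewrite andbT => /andP[d0 dN].
  rewrite -big_mkcondr /=.
  under eq_bigr do rewrite -[X in X / _]mulr1 -mulrA mulrC -mulrA.
  under eq_bigr do rewrite mul1r -[X in X * _]mul1r -mulrA.
  rewrite -mulr_suml.
  have dR : 0 < d%:R :> R by rewrite ltr0n.
  apply: le_trans (ler_wpM2r _ (hC d d0)) _.
    by rewrite mulr_ge0 // invr_ge0 exprn_ge0 // ltW.
  rewrite le_eqVlt; apply/orP; left; apply/eqP; field; exact: lt0r_neq0.
apply: (@le_trans _ _ (\sum_(1 <= p < N.+1)
    ((if (1 < p)%N then t p.-1 / p.-1%:R else 0) + 2 * (t p.+1 / p.+1%:R)))).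
  apply: ler_sum_subset => //; last first.
    move=> p _ _; rewrite addr_ge0 ?mulr_ge0 ?divr_ge0 ?invr_ge0 ?ler0n //.
    by case: ifP => // _; rewrite divr_ge0 ?ler0n.
  move=> p /andP[p0 pN] /andP[p_pr Yp]; split=> //.
  have p1 := prime_gt1 p_pr; rewrite p1.
  have [z0 zd] := hz p p_pr Yp.
  have pR : 0 < p%:R :> R by rewrite ltr0n.
  have pP : (0 < p.-1)%N by rewrite -subn1 subn_gt0.
  case/orP: zd => zd.
    rewrite -[leLHS]addr0; apply: lerD; last by rewrite mulr_ge0 // divr_ge0 ?ler0n.
    apply: ler_pM; rewrite ?invr_ge0 ?ler0n ?ler_nat ?size_divisors_dvd //.
    by rewrite lef_pV2 ?posrE ?ltr0n // ler_nat leq_pred.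
  rewrite -[leLHS]add0r; apply: lerD; first by rewrite divr_ge0 ?ler0n.
  rewrite mulrCA; apply: ler_pM; rewrite ?invr_ge0 ?ler0n ?ler_nat ?size_divisors_dvd //.
  rewrite ler_pdivlMr ?ltr0n // mulrC ler_pdivrMr //.
  by rewrite -natrM ler_nat; lia.
rewrite big_split /= -mulr_sumr.
have -> : 3 * T = T + 2 * T by ring.
apply: lerD.
  case: N {hC} @T T0 => [|N] T T0; first by rewrite big_geq.
  rewrite big_nat_recl //= add0r /T [leRHS](@big_cat_nat _ _ _ N.+1) //=; last by lia.
  rewrite -[leLHS]addr0; apply: lerD; last first.
    by apply: sumr_ge0 => i _; rewrite divr_ge0 ?ler0n.
  apply: ler_sum_subset => [i /andP[i0 _] _|i _ _]; last by rewrite divr_ge0 ?ler0n.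
  by split=> //; rewrite ltnS i0.
rewrite ler_wpM2l // /T [leRHS]big_nat_recl //=.
by rewrite lerDr divr_ge0 ?ler0n.
Qed.

(** * The first moment of gcd(n, u_n) *)

Lemma expR_ge_sqr (R : realType) (a : R) : 0 <= a -> a ^+ 2 / 4 <= expR a.
Proof.
move=> a0; have -> : a = a / 2 + a / 2 by lra.
rewrite expRD; have := expR_ge1Dx (a / 2).
have : 0 <= a / 2 by lra.
by move: (expR _) => b; nra.
Qed.

(** Here x = exp (exp t), so that t stands for log log x, and w < 1/2 is a
    parameter to be chosen close to 1/2. The exponent for the primes p beyond
    exp (sqrt (log x log log x) / 2) is eta = w t / log p, so that
    p ^ eta = (log x) ^ w, whereas x ^ (- eta) is estimated by the inequality
    between the arithmetic and geometric means. *)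
Lemma gcd_sum_bound (R : realType) (g z : nat -> nat) (C : R) (Y0 : nat) (t w : R) :
  let l := expR t in
  let x := expR l in
  let N := Num.truncn x in
  let S := Num.sqrt (l * t) in
  0 <= C ->
  (forall n, (0 < n)%N -> (g n %| n)%N) ->
  (forall n p, (0 < n)%N -> prime p -> (Y0 < p)%N -> (p %| g n)%N -> (z p %| n)%N) ->
  (forall p, prime p -> (Y0 < p)%N ->
    (0 < z p)%N /\ ((z p %| p.-1)%N || (z p %| p.+1)%N)) ->
  (forall Y d, (Y0 <= Y)%N -> (0 < d)%N ->
    \sum_(1 <= p < N.+1 | prime p && (Y < p)%N && (z p == d)) 1 <= C * d%:R) ->
  0 < w -> w < 2^-1 -> 32 <= t -> Y0%:R <= t ->
  \sum_(1 <= n < N.+1) (g n)%:R <=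
    x ^+ 2 * expR (- (2 * w * S) + 4 * expR (w * t) * (5 + 2 * t) +
      (9 * (C + 3) + 1) + 4 * t).
Proof.
move=> l x N S C0 hg hz0 hz hC w0 w1 t32 Yt.
have x0 : 0 < x := expR_gt0 _.
have lx : ln x = l by rewrite expRK.
have ll : ln l = t by rewrite expRK.
have lt : t + 1 <= l by rewrite addrC expR_ge1Dx.
have t0 : 0 < t by lra.
have l0 : 0 < l by lra.
have SS : S ^+ 2 = l * t by rewrite sqr_sqrtr // mulr_ge0 ?ltW.
have S0 : 0 < S by rewrite sqrtr_gt0 mulr_gt0.
have Nx : N%:R <= x by rewrite truncn_le ltW.
set v := S / 2.
have tv : t <= v.
  have h : (t / 2) ^+ 2 / 4 <= expR (t / 2) by apply: expR_ge_sqr; lra.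
  have hl : l = expR (t / 2) * expR (t / 2) by rewrite -expRD; congr expR; lra.
  have h2 : 2 * t <= expR (t / 2) by nra.
  have h3 : 2 * t <= S by nra.
  rewrite /v; lra.
have vl : v <= l by rewrite /v; nra.
set Y := Num.truncn (expR v).
have YN : (Y <= N)%N by apply: le_truncn; rewrite ler_expR.
have Y0Y : (Y0 <= Y)%N.
  rewrite truncn_ge_nat ?expR_ge0 //; have := expR_ge1Dx v; lra.
set M := expR (w * t).
have M0 : 0 < M := expR_gt0 _.
set P := 5 + 2 * t.
have hP p : (p <= N)%N -> prime_hsum R p <= P.
  move=> pN; apply: le_trans (prime_hsum_le _ pN) _.
  by rewrite /P -ll -lx; apply: prime_hsum_le_lnln; rewrite lx; lra.
set E := expR (4 * M * P).
have hE p : (p <= N)%N -> expR (4 * M * prime_hsum R p) <= E.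
  by move=> pN; rewrite ler_expR ler_pM2l ?hP // mulr_gt0.
have xpow a : x `^ a = expR (l * a) by rewrite /x -expRM.
(* For Y = exp v the exponent eta = w t / v gives x ^ (- eta) = exp (- 2 w S). *)
have smooth_part : \sum_(1 <= m < N.+1 | smooth Y m) 1 <= x * expR (- (2 * w * S)) * E.
  have v0 : 0 < v by lra.
  have eta0 : 0 <= w * t / v by rewrite divr_ge0 ?mulr_ge0 ?ltW.
  have eta1 : w * t / v <= 2^-1 by rewrite ler_pdivrMr //; nra.
  have YM : Y%:R `^ (w * t / v) <= M.
    apply: (@le_trans _ _ (expR v `^ (w * t / v))).
      by apply: ge0_ler_powR; rewrite ?nnegrE ?ler0n ?expR_ge0 // truncn_le expR_ge0.
    by rewrite -expRM ler_expR mulrC divfK // lt0r_neq0.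
  apply: le_trans (rankin_bound x0 _ eta0 eta1 YM) _.
    by move=> m mN; apply: le_trans Nx; rewrite ler_nat.
  have -> : x `^ (1 - w * t / v) = x * expR (- (2 * w * S)).
    rewrite xpow mulrBr mulr1 expRD; congr (_ * expR (- _)).
    rewrite /v; apply: (@mulIf _ S); first exact: lt0r_neq0.
    transitivity (2 * w * (l * t)); last by rewrite -SS expr2 !mulrA.
    by field; exact: lt0r_neq0.
  by rewrite ler_wpM2l ?hE // mulr_ge0 ?expR_ge0 // ltW.
set A := x * expR (- (2 * w * S)) * M ^+ 3 * E.
have prime_part : \sum_(1 <= p < N.+1 | prime p && (Y < p)%N)
    \sum_(e <- divisors (z p)) e%:R / (z p)%:R *
      \sum_(1 <= m < N.+1 | (max_pdiv m == p) && (e %| m)%N) 1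
    <= A * ((C + 3) * hsum R N.+1 ^+ 2).
  apply: (@le_trans _ _ (\sum_(1 <= p < N.+1 | prime p && (Y < p)%N)
      A * ((size (divisors (z p)))%:R / ((z p)%:R * Num.sqrt p%:R)))); last first.
    rewrite -mulr_sumr; apply: ler_wpM2l.
      by rewrite !mulr_ge0 ?exprn_ge0 ?expR_ge0 // ltW.
    apply: sum_rank_le => // [p p_pr Yp|d d0]; last exact: hC.
    by apply: hz => //; apply: leq_ltn_trans Yp.
  rewrite big_nat_cond [leRHS]big_nat_cond.
  apply: ler_sum => p /andP[/andP[p0 pN] /andP[p_pr Yp]].
  have [z0 zd] := hz p p_pr (leq_ltn_trans Y0Y Yp).
  have [cpz zp] := dvd_prime_pm1_coprime p_pr zd.
  have pR : 0 < p%:R :> R by rewrite ltr0n.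
  have vp : v < ln p%:R.
    rewrite -ltr_expR lnK ?posrE //.
    by rewrite truncn_lt_nat ?expR_ge0 // in Yp.
  set b := ln (p%:R : R) in vp.
  have b0 : 0 < b by lra.
  have eta0 : 0 <= w * t / b by rewrite divr_ge0 ?mulr_ge0 ?ltW.
  have eta1 : w * t / b <= 2^-1 by rewrite ler_pdivrMr //; nra.
  have pM : p%:R `^ (w * t / b) <= M.
    rewrite -[p%:R]lnK ?posrE // -expRM ler_expR -/b mulrC divfK //.
    exact: lt0r_neq0.
  apply: le_trans (weighted_count_max_pdiv_le x0 Nx eta0 eta1 pM p_pr z0 zp cpz) _.
  have sR : 0 < Num.sqrt p%:R :> R by rewrite sqrtr_gt0.
  have zR : 0 < (z p)%:R :> R by rewrite ltr0n.
  have sp : expR (b / 2) = Num.sqrt p%:R.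
    rewrite -[RHS]lnK ?posrE // ; congr expR.
    by rewrite -powR12_sqrt ?ltW // ln_powR mulrC.
  (* 2 S <= S ^ 2 / log p + log p trades smoothness against the size of p. *)
  have amgm : x `^ (- (w * t / b)) <= expR (- (2 * w * S)) * Num.sqrt p%:R.
    rewrite xpow -sp -expRD ler_expR.
    have e1 : l * - (w * t / b) = - (w * (S ^+ 2 / b)).
      by rewrite SS; field; exact: lt0r_neq0.
    have e2 : 2 * S <= S ^+ 2 / b + b.
      rewrite -subr_ge0.
      have -> : S ^+ 2 / b + b - 2 * S = (S - b) ^+ 2 / b by field; exact: lt0r_neq0.
      by rewrite divr_ge0 ?sqr_ge0 ?ltW.
    rewrite e1; move: (S ^+ 2 / b) e2 => q e2; nra.
  have -> : A * ((size (divisors (z p)))%:R / ((z p)%:R * Num.sqrt p%:R)) =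
      (size (divisors (z p)))%:R / ((z p)%:R * p%:R) *
      (x * (expR (- (2 * w * S)) * Num.sqrt p%:R) * M ^+ 3 * E).
    have := sqr_sqrtr (ltW pR); move: (Num.sqrt _) sR => s s0 ps; rewrite -ps /A.
    by field; rewrite !lt0r_neq0.
  apply: ler_wpM2l; first by rewrite divr_ge0 ?mulr_ge0 ?ler0n.
  apply: ler_pM; rewrite ?expR_ge0 ?mulr_ge0 ?exprn_ge0 ?powR_ge0 ?expR_ge0 ?(ltW x0) //.
    by rewrite ler_wpM2r ?exprn_ge0 ?expR_ge0 // ler_wpM2l // ltW.
  by apply: hE; rewrite -ltnS.
(* It remains to absorb powers of l = log x into exp (4 t). *)
have hN : hsum R N.+1 <= 3 * l.
  apply: le_trans (hsum_le_ln R (ltn0Sn N)) _.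
  have : ln (N.+1%:R : R) <= ln (2 * x).
    rewrite ler_ln ?posrE ?ltr0n //; last by rewrite mulr_gt0.
    have x1 : 1 <= x by rewrite -expR0 ler_expR ltW.
    rewrite -natr1; lra.
  rewrite lnM ?posrE // lx; have := @le_ln1Dx R 1; rewrite (_ : 1 + 1 = 2) // => /(_ _) h.
  have : ln (2 : R) <= 1 by apply: h; lra.
  lra.
have M3 : M ^+ 3 <= l ^+ 2.
  rewrite -!expRM_natl ler_expR; nra.
apply: le_trans (gcd_sum_split R (z := z) (Y := Y) N hg _ _) _.
- by move=> n p n0 p_pr Yp; apply: hz0 => //; apply: leq_ltn_trans Yp.
- by move=> p p_pr Yp; have [] := hz p p_pr (leq_ltn_trans Y0Y Yp).
rewrite expr2 -mulrA.
apply: ler_pM; rewrite ?ler0n //.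
  apply: addr_ge0; first by apply: sumr_ge0.
  apply: sumr_ge0 => p _; apply: sumr_ge0 => e _.
  by rewrite mulr_ge0 ?divr_ge0 ?ler0n // sumr_ge0.
apply: le_trans (lerD smooth_part prime_part) _.
set D := 9 * (C + 3) + 1.
set B := x * expR (- (2 * w * S)) * E.
have B0 : 0 <= B by rewrite !mulr_ge0 ?expR_ge0 // ltW.
have -> : x * expR (- (2 * w * S) + 4 * M * P + D + 4 * t) = B * (expR D * l ^+ 4).
  by rewrite 3!expRD expRM_natl /B /E !mulrA.
have -> : B + A * ((C + 3) * hsum R N.+1 ^+ 2) =
    B * (1 + M ^+ 3 * ((C + 3) * hsum R N.+1 ^+ 2)) by rewrite /A /B; ring.
apply: ler_wpM2l => //.
have l4 : 1 <= l ^+ 4 by rewrite exprn_ege1 //; lra.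
have H2 : hsum R N.+1 ^+ 2 <= 9 * l ^+ 2.
  have -> : 9 * l ^+ 2 = (3 * l) ^+ 2 by ring.
  by rewrite lerXn2r ?nnegrE ?hsum_ge0 //; lra.
have H3 : M ^+ 3 * hsum R N.+1 ^+ 2 <= l ^+ 2 * (9 * l ^+ 2).
  by apply: ler_pM; rewrite ?exprn_ge0 ?hsum_ge0 // ltW.
have DD : D <= expR D by have := expR_ge1Dx D; lra.
have l44 : l ^+ 2 * (9 * l ^+ 2) = 9 * l ^+ 4 by ring.
rewrite l44 in H3.
apply: (@le_trans _ _ (D * l ^+ 4)); last by rewrite ler_wpM2r //; lra.
rewrite mulrCA.
move: (M ^+ 3 * _) (l ^+ 4) H3 l4 => a c H3 l4.
rewrite /D; nra.
Qed.

(** With w = 1/2 - eps/4, the main factor is exp (- (1 - eps/2) S), where S stands for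
    sqrt (log x log log x), and the remaining factors are at most exp ((eps/2) S) for large t. *)
Lemma gcd_sum_bound_eventually (R : realType) (g z : nat -> nat) (C : R) (Y0 : nat) (eps : R) :
  0 <= C ->
  (forall n, (0 < n)%N -> (g n %| n)%N) ->
  (forall n p, (0 < n)%N -> prime p -> (Y0 < p)%N -> (p %| g n)%N -> (z p %| n)%N) ->
  (forall p, prime p -> (Y0 < p)%N ->
    (0 < z p)%N /\ ((z p %| p.-1)%N || (z p %| p.+1)%N)) ->
  (forall N Y d, (Y0 <= Y)%N -> (0 < d)%N ->
    \sum_(1 <= p < N.+1 | prime p && (Y < p)%N && (z p == d)) 1 <= C * d%:R) ->
  0 < eps -> eps <= 1 ->
  exists T : R, forall t, T <= t ->
    \sum_(1 <= n < (Num.truncn (expR (expR t))).+1) (g n)%:R <=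
      expR (expR t) ^+ 2 * expR (- ((1 - eps) * Num.sqrt (expR t * t))).
Proof.
move=> C0 hg hz0 hz hC e0 e1.
pose D : R := 9 * (C + 3) + 1.
exists (32 + Y0%:R + 128 * (32 + D) / eps ^+ 3) => t hT.
have e3 : 0 < eps ^+ 3 by rewrite exprn_gt0.
have D0 : 0 < D by rewrite /D; lra.
have Y0R : 0 <= Y0%:R :> R by rewrite ler0n.
have q0 : 0 <= 128 * (32 + D) / eps ^+ 3 by rewrite divr_ge0 ?(ltW e3) //; lra.
have t32 : 32 <= t by lra.
have Yt : Y0%:R <= t by lra.
have tq : 128 * (32 + D) <= t * eps ^+ 3 by rewrite -ler_pdivrMr //; lra.
pose w : R := 2^-1 - eps / 4.
have w0 : 0 < w by rewrite /w; lra.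
have w1 : w < 2^-1 by rewrite /w; lra.
apply: le_trans (gcd_sum_bound C0 hg hz0 hz (hC _) w0 w1 t32 Yt) _.
rewrite ler_wpM2l ?exprn_ge0 ?expR_ge0 // ler_expR -/D.
set S := Num.sqrt _.
have t0 : 0 <= t by lra.
have hS : expR (t / 2) <= S.
  have -> : expR (t / 2) = Num.sqrt (expR t).
    rewrite -powR12_sqrt ?expR_ge0 // -expRM //.
  rewrite ler_sqrt ?mulr_ge0 ?expR_ge0 //.
  by rewrite ler_peMr ?expR_ge0 //; lra.
have hexp : expR (t / 2) = expR (w * t) * expR (eps * t / 4).
  by rewrite -expRD; congr expR; rewrite /w; field.
have h1 : (eps * t / 4) ^+ 2 / 4 <= expR (eps * t / 4).
  by apply: expR_ge_sqr; rewrite divr_ge0 ?mulr_ge0 // ltW.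
have m1 : 1 <= expR (w * t) by rewrite -expR0 ler_expR mulr_ge0 // ltW.
have h2 : 2 * (20 + D + 12 * t) <= eps * expR (eps * t / 4).
  apply: (@le_trans _ _ (eps * ((eps * t / 4) ^+ 2 / 4))); last by rewrite ler_pM2l.
  have -> : eps * ((eps * t / 4) ^+ 2 / 4) = (t * eps ^+ 3) * t / 64 by field.
  have : 128 * (32 + D) * t <= t * eps ^+ 3 * t by rewrite ler_wpM2r.
  move: (t * eps ^+ 3 * t) => q hq; nra.
have h3 : 2 * (4 * expR (w * t) * (5 + 2 * t) + D + 4 * t) <= eps * expR (t / 2).
  rewrite hexp mulrCA.
  have : expR (w * t) * (2 * (20 + D + 12 * t)) <=
      expR (w * t) * (eps * expR (eps * t / 4)) by rewrite ler_wpM2l ?expR_ge0.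
  move: (eps * expR _) (expR (w * t)) m1 => a m m1 hm; nra.
have h4 : eps * expR (t / 2) <= eps * S by rewrite ler_pM2l.
have -> : 2 * w * S = S - eps * S / 2 by rewrite /w; field.
have -> : (1 - eps) * S = S - eps * S by ring.
lra.
Qed.

(** * Moments of the greatest common divisor *)

(** The primes of rank d divide u_d, which is non-zero and at most exponential. *)
Lemma count_rank_le (R : realType) (u : nat -> int) (z : nat -> nat) (C Y0 : nat) :
  (forall n, (0 < n)%N -> u n != 0) ->
  (forall n, (`|u n| <= 2 ^ (C * n))%N) ->
  (forall p, prime p -> (Y0 < p)%N -> (p %| `|u (z p)|)%N) ->
  forall N Y d, (Y0 <= Y)%N -> (0 < d)%N ->
    \sum_(1 <= p < N.+1 | prime p && (Y < p)%N && (z p == d)) 1 <= C%:R * d%:R :> R.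
Proof.
move=> u0 uC hz N Y d YY d0.
rewrite big_const_seq iter_addr_0 -natrM ler_nat -size_filter.
have ud0 : (0 < `|u d|)%N by rewrite absz_gt0 u0.
apply: (@leq_trans (size (primes `|u d|))).
  apply: uniq_leq_size; first by rewrite filter_uniq // iota_uniq.
  move=> p; rewrite mem_filter => /andP[/andP[/andP[p_pr Yp] /eqP zp] _].
  by rewrite mem_primes p_pr ud0 -zp hz // (leq_ltn_trans YY).
rewrite -(leq_exp2l _ _ (isT : (1 < 2)%N)).
exact: leq_trans (exp2_size_primes ud0) (uC d).
Qed.

(** Since gcd(n, u_n) <= n <= x, the higher moments follow from the first. *)
Lemma gcd_power_sum_le (R : realType) (u : nat -> int) (k : nat) (x : R) : 0 <= x ->
  gcd_power_sum u k.+1 x <=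
  x ^+ k * \sum_(1 <= n < (Num.truncn x).+1) (gcd_term u n)%:R.
Proof.
move=> x0; rewrite /gcd_power_sum mulr_sumr big_nat_cond [leRHS]big_nat_cond.
apply: ler_sum => n; rewrite andbT => /andP[n0 nN].
rewrite exprSr ler_wpM2r ?ler0n // lerXn2r ?nnegrE ?ler0n //.
apply: (@le_trans _ _ n%:R).
  by rewrite ler_nat dvdn_leq // dvdn_gcdl.
by rewrite -truncn_ge_nat.
Qed.

Lemma gcd_power_sum_ge1 (R : realType) (u : nat -> int) (k : nat) (x : R) : 1 <= x ->
  1 <= gcd_power_sum u k x.
Proof.
move=> x1; rewrite /gcd_power_sum big_ltn; last by rewrite ltnS truncn_gt0.
rewrite /gcd_term gcd1n expr1n lerDl.
by apply: sumr_ge0 => i _; rewrite exprn_ge0.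
Qed.

(** The bound of the theorem with a fixed eps in place of o(1). *)
Lemma lucas_gcd_moment_le (R : realType) (a1 a2 : int) (u : nat -> int) (k : nat) (eps : R) :
  lucas_sequence a1 a2 u -> lucas_nondegenerate R a1 a2 ->
  lucas_discr a1 a2 != 0 -> 0 < eps -> eps <= 1 ->
  \forall x \near +oo_R, gcd_power_sum u k.+1 x <=
    x ^+ k.+2 * expR (- ((1 - eps) * Num.sqrt (ln x * ln (ln x)))).
Proof.
move=> hu hnd hD e0 e1; have [a20 _ _ _] := hu.
have [C uC] := lucas_abs_bound hu.
(* Primes beyond Y0 divide neither a2 nor the discriminant, so they have a rank. *)
pose Y0 := maxn `|a2| `|lucas_discr a1 a2|.
have ndvd p (m : int) : m != 0 -> (`|m| < p)%N -> ~~ (p %| `|m|)%N.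
  by move=> m0 mp; rewrite gtnNdvd // absz_gt0.
have /choice[z hz] : forall p, exists z, prime p -> (Y0 < p)%N ->
    [/\ (0 < z)%N, (p %| `|u z|)%N,
    (forall n, (p %| `|u n|)%N -> (z %| n)%N) &
    (z %| p.-1)%N || (z %| p.+1)%N].
  move=> p.
  have [p_pr|] := boolP (prime p); last by exists 0%N.
  have [|] := ltnP Y0 p; last by exists 0%N.
  rewrite gtn_max => /andP[p1 p2].
  have [z hz] := lucas_rank_exists hu p_pr (ndvd _ _ a20 p1) (ndvd _ _ hD p2).
  by exists z.
have h1 n : (0 < n)%N -> (gcd_term u n %| n)%N by move=> _; apply: dvdn_gcdl.
have h2 n p : (0 < n)%N -> prime p -> (Y0 < p)%N -> (p %| gcd_term u n)%N -> (z p %| n)%N.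
  move=> _ p_pr Yp pg; have [_ _ h _] := hz p p_pr Yp.
  by apply: h; apply: dvdn_trans pg (dvdn_gcdr _ _).
have h3 p : prime p -> (Y0 < p)%N -> (0 < z p)%N /\ ((z p %| p.-1)%N || (z p %| p.+1)%N).
  by move=> p_pr Yp; have [] := hz p p_pr Yp.
have u0 n : (0 < n)%N -> u n != 0 by move=> n0; apply: lucas_neq0 hu hnd hD n0.
have h4 p : prime p -> (Y0 < p)%N -> (p %| `|u (z p)|)%N.
  by move=> p_pr Yp; have [] := hz p p_pr Yp.
have [T hT] := gcd_sum_bound_eventually (ler0n _ C) h1 h2 h3
  (count_rank_le R u0 uC h4) e0 e1.
near=> x.
have x0 : 0 < x by near: x; apply: nbhs_pinfty_gt; rewrite num_real.
have xT : expR (expR T) <= x by near: x; apply: nbhs_pinfty_ge; rewrite num_real.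
have l0 : 0 < ln x.
  by apply: lt_le_trans (expR_gt0 T) _; rewrite -ler_expR lnK ?posrE.
have tT : T <= ln (ln x) by rewrite -ler_expR lnK ?posrE // -ler_expR lnK ?posrE.
apply: le_trans (gcd_power_sum_le _ _ (ltW x0)) _.
have := hT _ tT; rewrite !lnK ?posrE // => h.
rewrite -[k.+2]addn2 exprD -mulrA; apply: ler_wpM2l => //.
by rewrite exprn_ge0 // ltW.
Unshelve. all: by end_near. Qed.

Lemma lnln_gt0 (R : realType) (x : R) : expR (expR 1) <= x ->
  1 <= x /\ 0 < Num.sqrt (ln x * ln (ln x)).
Proof.
move=> xe; have x1 : 1 <= x by apply: le_trans xe; rewrite -expR0 ler_expR expR_ge0.
split=> //; have x0 : 0 < x by apply: lt_le_trans x1.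
have l1 : expR 1 <= ln x by rewrite -ler_expR lnK ?posrE.
have l0 : 0 < ln x := lt_le_trans (expR_gt0 _) l1.
rewrite sqrtr_gt0 mulr_gt0 //.
by apply: lt_le_trans ltr01 _; rewrite -ler_expR lnK ?posrE.
Qed.

Theorem theorem1p3 (R : realType) (a1 a2 : int) (u : nat -> int)
    (hu : lucas_sequence a1 a2 u)
    (hnd : lucas_nondegenerate R a1 a2)
    (hdiscr : lucas_discr a1 a2 != 0)
    (k : nat) (hk : (1 <= k)%N) :
  exists2 o : R -> R, o x @[x --> +oo_R] --> 0 &
    \forall x \near +oo_R,
      gcd_power_sum u k x
        <= x ^+ k.+1 * expR (- ((1 + o x) * Num.sqrt (ln x * ln (ln x)))).
Proof.
have [k' ->] : exists k', k = k'.+1 by exists k.-1; rewrite prednK.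
pose L (x : R) := Num.sqrt (ln x * ln (ln x)).
pose S (x : R) := gcd_power_sum u k'.+1 x.
(* The exact value of the error term, truncated from above at 0: nothing
   prevents the sum from being much smaller than the bound. *)
pose e (x : R) := - 1 - ln (S x / x ^+ k'.+2) / L x.
exists (fun x => Num.min 0 (e x)).
  apply/cvgr0Pnorm_le => eps eps0.
  have m0 : 0 < Num.min eps 1 by rewrite lt_min eps0 ltr01.
  have m1 : Num.min eps 1 <= 1 by rewrite ge_min lexx orbT.
  have := lucas_gcd_moment_le k' hu hnd hdiscr m0 m1.
  set eps' := Num.min eps 1 in m0 m1 * => hnear.
  near=> x.
  have hx : S x <= x ^+ k'.+2 * expR (- ((1 - eps') * L x)) by near: x.
  have xe : expR (expR 1) <= x by near: x; apply: nbhs_pinfty_ge; rewrite num_real.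
  have [x1 L0] := lnln_gt0 xe.
  have x0 : 0 < x by apply: lt_le_trans x1.
  have S0 : 0 < S x by apply: lt_le_trans ltr01 (gcd_power_sum_ge1 _ _ x1).
  have xk : 0 < x ^+ k'.+2 by rewrite exprn_gt0.
  have he : - eps' <= e x.
    have h : ln (S x / x ^+ k'.+2) <= - ((1 - eps') * L x).
      rewrite -ler_expR lnK ?posrE ?divr_gt0 //.
      by rewrite ler_pdivrMr // mulrC.
    have : ln (S x / x ^+ k'.+2) / L x <= - (1 - eps').
      by rewrite ler_pdivrMr // mulNr.
    by rewrite /e; lra.
  have he' : eps' <= eps by rewrite ge_min lexx.
  rewrite ler0_norm; last by rewrite ge_min lexx.
  rewrite lerNl le_min; apply/andP; split; lra.
near=> x.
have xe : expR (expR 1) <= x by near: x; apply: nbhs_pinfty_ge; rewrite num_real.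
have [x1 L0] := lnln_gt0 xe.
have x0 : 0 < x by apply: lt_le_trans x1.
have S0 : 0 < S x by apply: lt_le_trans ltr01 (gcd_power_sum_ge1 _ _ x1).
have xk : 0 < x ^+ k'.+2 by rewrite exprn_gt0.
rewrite -/(S x) -/(L x) mulrC -ler_pdivrMr // -[leLHS]lnK ?posrE ?divr_gt0 //.
rewrite ler_expR.
have -> : ln (S x / x ^+ k'.+2) = - ((1 + e x) * L x).
  by rewrite /e; field; exact: lt0r_neq0.
rewrite lerN2 ler_wpM2r ?(ltW L0) // lerD2l.
by rewrite ge_min lexx orbT.
Unshelve. all: by end_near. Qed.
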